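(* Let $R$ be a term rewriting system over a signature $\Sigma$ and let $T \subseteq \mathcal{T}(\Sigma,\emptyset)$ be a set of ground terms. Then $R$ is terminating on $T$ if and only if there exists a well-founded monotone partial $\Sigma$-algebra $(A,[\![\cdot]\!],\succ)$ such that $T$ is defined (i.e. $[\![t]\!]$ is defined for every $t\in T$) and $\succ$ is a partial model for $R$.
   Context: A TRS $R$ over $\Sigma$ is a set of rules $\ell\to r$ with $\ell,r\in\mathcal{T}(\Sigma,\mathcal{X})$, $\ell\notin\mathcal{X}$, $\mathrm{Var}(r)\subseteq\mathrm{Var}(\ell)$; $\to_R$ is the usual one-step rewrite relation (closed under substitutions and contexts). $R$ is terminating on a set $T$ of terms if no $t\in T$ admits an infinite sequence $t=t_1\to_R t_2\to_R\cdots$ (the $t_i$, $i\ge 2$, need not lie in $T$). A partial $\Sigma$-algebra $(A,[\![\cdot]\!])$ consists of a non-empty set $A$ and for each $n$-ary $f\in\Sigma$ a partial function $[\![f]\!]:A^n\rightharpoonup A$. For a total assignment $\alpha:\mathcal{X}\to A$, the (possibly undefined) interpretation of terms is $[\![x]\!]_\alpha=\alpha(x)$ and $[\![f(t_1,\dots,t_n)]\!]_\alpha=[\![f]\!]([\![t_1]\!]_\alpha,\dots,[\![t_n]\!]_\alpha)$, which is defined only if all $[\![t_i]\!]_\alpha$ are defined and the tuple lies in the domain of $[\![f]\!]$; for ground $t$ write $[\![t]\!]$. Given a binary relation $\succ$ on $A$, a partial function $f$ is closed w.r.t. $\succ$ if whenever $f(\dots,a,\dots)$ is defined and $a\succ b$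 then $f(\dots,b,\dots)$ (same other arguments, same position) is defined; it is monotone w.r.t. $\succ$ if whenever $f(\dots,a,\dots)$ and $f(\dots,b,\dots)$ are defined and $a\succ b$ then $f(\dots,a,\dots)\succ f(\dots,b,\dots)$ (for every argument position). A monotone partial $\Sigma$-algebra $(A,[\![\cdot]\!],\succ)$ is a partial $\Sigma$-algebra with a relation $\succ$ on $A$ such that every $[\![f]\!]$ is closed and monotone w.r.t. $\succ$; it is well-founded if $\succ$ is well-founded. $\succ$ is a partial model for $R$ if for every rule $\ell\to r\in R$ and every $\alpha:\mathrm{Var}(\ell)\to A$: if $[\![\ell]\!]_\alpha$ is defined then $[\![\ell]\!]_\alpha\succ[\![r]\!]_\alpha$ (in particular $[\![r]\!]_\alpha$ is defined). *)

(* Defs.v *)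
From mathcomp Require Import all_boot.

Set Implicit Arguments.
Unset Strict Implicit.
Unset Printing Implicit Defensive.

Record signature : Type := Signature { symbol :> Type; arity : symbol -> nat }.

(* T(S, X); ground terms are [term S void]. *)
Inductive term (S : signature) (X : Type) : Type :=
| Var of X
| App (f : S) of {ffun 'I_(arity f) -> term S X}.

Arguments Var {S X} x.
Arguments App {S X} f ts.

Definition upd (n : nat) (A : Type) (v : {ffun 'I_n -> A}) (i : 'I_n) (a : A) :
  {ffun 'I_n -> A} := [ffun j => if j == i then a else v j].

Section Terms.
Context {S : signature}.

Inductive occurs {X : Type} (x : X) : term S X -> Prop :=
| occurs_var : occurs x (Var x)
| occurs_app (f : S) (ts : {ffun 'I_(arity f) -> term S X}) (i : 'I_(arity f)) :
    occurs x (ts i) -> occurs x (App f ts).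

Fixpoint subst {X Y : Type} (s : X -> term S Y) (t : term S X) : term S Y :=
  match t with
  | Var x => s x
  | App f ts => App f [ffun i => subst s (ts i)]
  end.

Definition of_ground {X : Type} : term S void -> term S X :=
  subst (of_void (term S X)).

End Terms.

Record trs (S : signature) (X : Type) : Type := Trs {
  rule :> term S X -> term S X -> Prop;
  rule_lhs_nonvar : forall l r, rule l r -> forall x, l <> Var x;
  rule_vars : forall l r, rule l r -> forall x, occurs x r -> occurs x l
}.

Inductive rewrites {S : signature} {X : Type} (R : trs S X) :
  term S X -> term S X -> Prop :=
| rewrites_root (l r : term S X) (s : X -> term S X) :
    R l r -> rewrites R (subst s l) (subst s r)
| rewrites_arg (f : S) (ts : {ffun 'I_(arity f) -> term S X})
    (i : 'I_(arity f)) (u : term S X) :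
    rewrites R (ts i) u -> rewrites R (App f ts) (App f (upd ts i u)).

Definition terminating_on {S : signature} {X : Type} (R : trs S X)
    (T : term S X -> Prop) : Prop :=
  forall t, T t ->
    ~ exists u : nat -> term S X,
        u 0 = t /\ forall i, rewrites R (u i) (u i.+1).

(* [op f v = None] means that v lies outside the domain of f; the field
   [point] witnesses that the carrier is non-empty. *)
Record palgebra (S : signature) : Type := PAlgebra {
  carrier :> Type;
  point : carrier;
  op : forall f : S, {ffun 'I_(arity f) -> carrier} -> option carrier
}.

(* The default [point A] is never reached: it stands for the value of an
   undefined argument, which the test excludes. *)
Fixpoint interp {S : signature} (A : palgebra S) {X : Type} (alpha : X -> A)
    (t : term S X) : option A :=
  match t with
  | Var x => Some (alpha x)
  | App f ts =>
      if [forall i, isSome (interp alpha (ts i))]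
      then op [ffun i => odflt (point A) (interp alpha (ts i))]
      else None
  end.

Definition ground_interp {S : signature} (A : palgebra S) (t : term S void) :
  option A := interp (of_void A) t.

Section Monotone.
Context {A : Type} (gt : A -> A -> Prop).

Definition closed_pfun (n : nat) (f : {ffun 'I_n -> A} -> option A) : Prop :=
  forall v i a b,
    isSome (f (upd v i a)) -> gt a b -> isSome (f (upd v i b)).

Definition monotone_pfun (n : nat) (f : {ffun 'I_n -> A} -> option A) : Prop :=
  forall v i a b c d,
    f (upd v i a) = Some c -> f (upd v i b) = Some d -> gt a b -> gt c d.

End Monotone.

Record monotone_palgebra (S : signature) : Type := MonotonePAlgebra {
  palg :> palgebra S;
  gt : palg -> palg -> Prop;
  op_closed : forall f : S, closed_pfun gt (@op S palg f);
  op_monotone : forall f : S, monotone_pfun gt (@op S palg f)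
}.

(* Stdlib's [well_founded] expects the smaller element on the left. *)
Definition well_founded_palgebra {S : signature} (A : monotone_palgebra S) :
  Prop := well_founded (fun a b : A => gt b a).

Definition partial_model {S : signature} {X : Type} (A : monotone_palgebra S)
    (R : trs S X) : Prop :=
  forall l r, R l r -> forall (alpha : X -> A) (a : A),
    interp alpha l = Some a ->
    exists2 b : A, interp alpha r = Some b & gt a b.

(* Main.v *)
Require Import Defs.
From mathcomp Require Import all_boot.
From mathcomp Require Import boolp.

Set Implicit Arguments.
Unset Strict Implicit.
Unset Printing Implicit Defensive.

(** If an algebra as in the theorem exists, every rewrite step from a term with
    a defined value leads to a term with a defined, strictly smaller value, so
    that an infinite reduction would give an infinite descent.
    Conversely, let the symbols act on terms by term formation, an operation
    being defined only if the term it builds is strongly normalizing, and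
    compare strongly normalizing terms by rewriting.  Since [term S X] may be
    empty, the carrier is [option (term S X)], where [None] is a junk element
    on which every operation is undefined. *)

Section TermInduction.
Variables (S : signature) (X : Type) (P : term S X -> Prop).
Hypothesis PVar : forall x, P (Var x).
Hypothesis PApp : forall (f : S) (ts : {ffun 'I_(arity f) -> term S X}),
  (forall i, P (ts i)) -> P (App f ts).

(* The generated [term_ind] has no induction hypothesis for the arguments,
   which are nested in a [{ffun _}]. *)
Fixpoint term_nested_ind (t : term S X) : P t :=
  match t with
  | Var x => PVar x
  | App f ts => PApp (fun i => term_nested_ind (ts i))
  end.

End TermInduction.

Section Upd.
Variables (n : nat) (A : Type).
Implicit Types (v : {ffun 'I_n -> A}) (i : 'I_n) (a : A).

Lemma upd_same v i : upd v i (v i) = v.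
Proof. by apply/ffunP => j; rewrite ffunE; case: eqP => // ->. Qed.

Lemma upd_at v i a : upd v i a i = a.
Proof. by rewrite ffunE eqxx. Qed.

End Upd.

(** * Accessibility and infinite descent *)

Lemma Acc_no_descent (A : Type) (gt : A -> A -> Prop) (u : nat -> A) :
  (forall i, gt (u i) (u i.+1)) -> ~ Acc (fun a b => gt b a) (u 0).
Proof.
move=> ugt acc0; move: {1 2}(u 0) acc0 (erefl (u 0)) => a acca.
elim: acca u ugt => {}a _ IH u ugt a_u0.
by apply: (IH (u 1) _ (fun i => u i.+1)); rewrite // a_u0.
Qed.

(** Classically, an inaccessible element has an inaccessible one below it. Choice turns this into a
    function [g], which is iterated from [a]; on accessible elements the value of [g] is
    arbitrary. *)
Lemma not_Acc_descent (A : Type) (gt : A -> A -> Prop) (a : A) :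
  ~ Acc (fun a b => gt b a) a ->
  exists u : nat -> A, u 0 = a /\ forall i, gt (u i) (u i.+1).
Proof.
move=> naccA.
have step b : exists c,
    ~ Acc (fun a b => gt b a) b -> gt b c /\ ~ Acc (fun a b => gt b a) c.
  case: (pselect (Acc (fun a b => gt b a) b)) => [accb|naccb]; first by exists b.
  apply: contra_notP naccb => /forallNP all_acc.
  constructor=> c gtbc; apply: contra_notP (all_acc c) => naccc.
  by split.
have [g gP] := choice step.
have nacc i : ~ Acc (fun a b => gt b a) (iter i g a).
  by elim: i => //= i /gP [].
by exists (fun i => iter i g a); split=> // i; have [] := gP _ (nacc i).
Qed.

(** * Interpretation and substitution *)

Section Interp.
Variables (S : signature) (A : palgebra S).

Lemma interp_AppP (X : Type) (alpha : X -> A) (f : S) ts a :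
  interp alpha (App f ts) = Some a <->
  exists2 v : {ffun 'I_(arity f) -> A},
    forall i, interp alpha (ts i) = Some (v i) & op v = Some a.
Proof.
rewrite /=; split=> [|[v tsv <-]].
  case: ifP => // /forallP def opa.
  exists [ffun i => odflt (point A) (interp alpha (ts i))] => // i.
  by rewrite ffunE; case: (interp alpha (ts i)) (def i).
rewrite ifT; last by apply/forallP => i; rewrite tsv.
by congr op; apply/ffunP => i; rewrite ffunE tsv.
Qed.

Variables (X Y : Type) (s : X -> term S Y) (alpha : Y -> A).

(** Only occurring variables are constrained, because [interp alpha (s x)] may be undefined at the
    others. *)
Lemma interp_subst (beta : X -> A) t :
  (forall x, occurs x t -> interp alpha (s x) = Some (beta x)) ->
  interp alpha (subst s t) = interp beta t.
Proof.
elim/term_nested_ind: t => [x|f ts IH] sbeta.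
  exact/sbeta/occurs_var.
have eq_args i : interp alpha (subst s (ts i)) = interp beta (ts i).
  by apply: IH => x xts; apply/sbeta/occurs_app/xts.
rewrite /=; under eq_forallb do rewrite ffunE eq_args.
by case: ifP => // _; congr op; apply/ffunP => i; rewrite !ffunE eq_args.
Qed.

Lemma interp_subst_occurs t a x :
  interp alpha (subst s t) = Some a -> occurs x t ->
  isSome (interp alpha (s x)).
Proof.
move=> ta xt; elim: xt a ta => [a /= -> //|f ts i _ IH a].
by case/interp_AppP=> v /(_ i); rewrite ffunE => /IH.
Qed.

End Interp.

(** * From an algebra to termination *)

Section Soundness.
Variables (S : signature) (X : Type) (R : trs S X) (A : monotone_palgebra S).
Hypothesis modelA : partial_model A R.

(** At the root, a defined instance of [l] gives values to the variables of [l], hence to those of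
    [r], and the model property applies. Below a symbol, closedness keeps the value defined and
    monotonicity makes it decrease. *)
Lemma interp_rewrites (alpha : X -> A) t u a :
  rewrites R t u -> interp alpha t = Some a ->
  exists2 b, interp alpha u = Some b & gt a b.
Proof.
move=> tu; elim: tu a => {t u} [l r s lr a sla|f ts i u _ IH a].
  pose beta x := odflt (point A) (interp alpha (s x)).
  have beta_l x : occurs x l -> interp alpha (s x) = Some (beta x).
    move=> /(interp_subst_occurs sla); rewrite /beta.
    by case: (interp alpha (s x)).
  have beta_r x : occurs x r -> interp alpha (s x) = Some (beta x).
    by move=> /(rule_vars lr)/beta_l.
  rewrite (interp_subst beta_r); apply: (modelA lr).
  by rewrite -(interp_subst beta_l).
case/interp_AppP=> v tsv va.
have [b ub gtvb] := IH _ (tsv i).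
have := va; rewrite -(upd_same v i) => vi_a.
have := @op_closed _ A f v i _ b _ gtvb; rewrite vi_a => /(_ isT).
case vb : (op (upd v i b)) => [d|//] _.
exists d; last exact: (op_monotone vi_a vb).
apply/interp_AppP; exists (upd v i b) => // j.
by rewrite !ffunE; case: eqP.
Qed.

Lemma partial_model_terminating (T : term S void -> Prop) :
  well_founded_palgebra A -> (forall t, T t -> isSome (ground_interp A t)) ->
  terminating_on R (fun t => exists2 u, T u & t = of_ground u).
Proof.
move=> wfA defT _ [t Tt ->] [u [u0 stepu]].
(* Reducts are terms over [X] and so require an assignment; any one will do, since the reduction
   starts from a ground term. *)
pose alpha (_ : X) := point A.
have def i : isSome (interp alpha (u i)).
  elim: i => [|i].
    by rewrite u0 /of_ground (@interp_subst _ _ _ _ _ _ (of_void A)) ?defT.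
  case ua : (interp alpha (u i)) => [a|//] _.
  by have [b -> _] := interp_rewrites (stepu i) ua.
pose w i := odflt (point A) (interp alpha (u i)).
have wE i : interp alpha (u i) = Some (w i).
  by rewrite /w; case: (interp alpha (u i)) (def i).
apply: (@Acc_no_descent _ (@gt _ A) w) (wfA _) => i.
by have [b] := interp_rewrites (stepu i) (wE i); rewrite wE => -[->].
Qed.

End Soundness.

(** * The term algebra of a rewrite system *)

Section TermAlgebra.
Variables (S : signature) (X : Type) (R : trs S X).

Definition strongly_normalizing : term S X -> Prop :=
  Acc (fun u t => rewrites R t u).

Notation SN := strongly_normalizing.

Lemma SN_step t u : SN t -> rewrites R t u -> SN u.
Proof. by move=> [SNt] /SNt. Qed.

Lemma SN_arg (f : S) ts (i : 'I_(arity f)) : SN (App f ts) -> SN (ts i).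
Proof.
move tE : (App f ts) => t SNt.
elim: SNt ts tE => {}t _ IH ts tE; constructor=> u tsu.
(* The reduct [u] of the argument is entry [i] of a reduct of the whole term, to which the induction
   hypothesis applies. *)
rewrite -[u](upd_at ts i); apply: IH (erefl _).
by rewrite -tE; apply: rewrites_arg.
Qed.

Lemma terminating_SN (T : term S X -> Prop) t :
  terminating_on R T -> T t -> SN t.
Proof.
move=> terT Tt; apply: contra_notP (terT t Tt) => nSNt.
exact: not_Acc_descent nSNt.
Qed.

Definition SN_args (f : S) (v : {ffun 'I_(arity f) -> option (term S X)}) :=
  exists ts : {ffun 'I_(arity f) -> term S X},
    v = [ffun i => Some (ts i)] /\ SN (App f ts).

(** The vector [v] determines the terms picked by [cid], so the choice does not affect the value. *)
Definition SN_op (f : S) (v : {ffun 'I_(arity f) -> option (term S X)}) :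
    option (option (term S X)) :=
  if pselect (SN_args v) is left h then Some (Some (App f (projT1 (cid h))))
  else None.

Lemma SN_opP (f : S) (v : {ffun 'I_(arity f) -> option (term S X)}) a :
  SN_op v = Some a <->
  exists ts : {ffun 'I_(arity f) -> term S X},
    [/\ v = [ffun i => Some (ts i)], SN (App f ts) & a = Some (App f ts)].
Proof.
rewrite /SN_op; case: pselect => [h|nh]; last first.
  by split=> // -[ts [vE SNts _]]; case: nh; exists ts.
case: cid => ts' /= [vE SNts']; split=> [[<-]|[ts [vE' _ ->]]].
  by exists ts'.
have -> : ts' = ts; last by [].
apply/ffunP => i.
by move: vE; rewrite vE' => /ffunP/(_ i); rewrite !ffunE => -[].
Qed.

Definition SN_palgebra : palgebra S := PAlgebra None SN_op.

(** The carrier also contains terms that are not strongly normalizing; requiring [SN t] leaves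
    nothing below them. *)
Definition SN_gt (a b : option (term S X)) : Prop :=
  if (a, b) is (Some t, Some u) then SN t /\ rewrites R t u else False.

(** A step in an argument is a step of the whole term, and strong normalization passes to reducts.
    This yields closedness and monotonicity together. *)
Lemma SN_op_upd (f : S) v (i : 'I_(arity f)) a b c :
  SN_op (upd v i a) = Some c -> SN_gt a b ->
  exists2 d, SN_op (upd v i b) = Some d & SN_gt c d.
Proof.
case/SN_opP=> ts [vE SNts ->]; case: a b vE => [t|//] [u|//] vE [_ tu].
have ti : ts i = t.
  by move/ffunP/(_ i): vE; rewrite upd_at ffunE => -[].
have step : rewrites R (App f ts) (App f (upd ts i u)).
  by apply: rewrites_arg; rewrite ti.
exists (Some (App f (upd ts i u))); last by [].
apply/SN_opP; exists (upd ts i u); split; [|exact: SN_step step|by []].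
apply/ffunP => j; move/ffunP/(_ j): vE; rewrite !ffunE.
by case: eqP.
Qed.

Lemma SN_op_closed (f : S) : closed_pfun SN_gt (@SN_op f).
Proof.
move=> v i a b; case va : (SN_op (upd v i a)) => [c|//] _ gtab.
by have [d ->] := SN_op_upd va gtab.
Qed.

Lemma SN_op_monotone (f : S) : monotone_pfun SN_gt (@SN_op f).
Proof.
move=> v i a b c d va vb gtab.
by have [d'] := SN_op_upd va gtab; rewrite vb => -[->].
Qed.

Definition SN_algebra : monotone_palgebra S :=
  @MonotonePAlgebra S SN_palgebra SN_gt SN_op_closed SN_op_monotone.

Lemma SN_algebra_wf : well_founded_palgebra SN_algebra.
Proof.
have accSN t : SN t -> Acc (fun a b => SN_gt b a) (Some t).
  by elim=> {}t _ IH; constructor=> -[u|//] [_] /IH.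
case=> [t|]; last by constructor=> -[].
by constructor=> -[u|//] [/SN_step SNt /SNt/accSN].
Qed.

(** Arguments of strongly normalizing terms are strongly normalizing, so every operation met in the
    evaluation is defined. *)
Lemma interp_SN_algebra (Y : Type) (s : Y -> term S X) (alpha : Y -> SN_algebra)
    t :
  (forall x, occurs x t -> alpha x = Some (s x)) -> SN (subst s t) ->
  interp alpha t = Some (Some (subst s t)).
Proof.
elim/term_nested_ind: t => [x|f ts IH] alphaE SNt.
  by congr Some; apply/alphaE/occurs_var.
apply/interp_AppP; exists [ffun i => Some (subst s (ts i))] => [i|].
  rewrite ffunE; apply: IH => [x xts|]; first exact/alphaE/occurs_app/xts.
  by have := SN_arg i SNt; rewrite ffunE.
apply/SN_opP; exists [ffun i => subst s (ts i)]; split; [|exact: SNt|by []].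
by apply/ffunP => i; rewrite !ffunE.
Qed.

(** A junk value at [x] is either the value of the whole term or makes the operation directly above
    it undefined. *)
Lemma interp_SN_algebra_occurs (Y : Type) (alpha : Y -> SN_algebra) t u x :
  interp alpha t = Some (Some u) -> occurs x t -> alpha x <> None.
Proof.
move=> tu xt; elim: xt u tu => [u /= [->] //|f ts i _ IH u].
case/interp_AppP=> v tsv /SN_opP [us [vE _ _]].
by apply: (IH (us i)); rewrite tsv vE ffunE.
Qed.

Lemma interp_SN_algebra_inv (Y : Type) (s : Y -> term S X)
    (alpha : Y -> SN_algebra) t u :
  (forall x, occurs x t -> alpha x = Some (s x)) ->
  interp alpha t = Some (Some u) -> u = subst s t.
Proof.
elim/term_nested_ind: t u => [x|f ts IH] u alphaE.
  by rewrite /= alphaE => [[->]|]; last exact: occurs_var.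
case/interp_AppP=> v tsv /SN_opP [us [vE _ [->]]] /=.
congr App; apply/ffunP => i; rewrite ffunE; apply: IH => [x xts|].
  exact/alphaE/occurs_app/xts.
by rewrite tsv vE ffunE.
Qed.

Lemma SN_algebra_model : partial_model SN_algebra R.
Proof.
move=> l r lr alpha a la.
have [t tE SNt] : exists2 t, a = Some t & SN t.
  (* As [l] is not a variable, its value is the result of an operation, hence strongly normalizing;
     a variable could take any value. *)
  case: l lr la => [x|f ts] lr; first by case: (rule_lhs_nonvar lr (erefl _)).
  by case/interp_AppP=> v _ /SN_opP [us [_ SNus ->]]; exists (App f us).
move: la; rewrite {a}tE => la.
(* The default only makes [s] total: [alpha] is never [None] on the variables of [l]. *)
pose s x := odflt (Var x) (alpha x).
have alphaE x : occurs x l -> alpha x = Some (s x).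
  by move=> /(interp_SN_algebra_occurs la); rewrite /s; case: (alpha x).
have tE := interp_SN_algebra_inv alphaE la.
have step : rewrites R t (subst s r) by rewrite tE; apply: rewrites_root.
exists (Some (subst s r)); last by [].
apply: interp_SN_algebra (SN_step SNt step) => x /(rule_vars lr).
exact: alphaE.
Qed.

End TermAlgebra.

Theorem theorem3p5 (S : signature) (X : Type) (R : trs S X)
    (T : term S void -> Prop) :
  terminating_on R (fun t => exists2 u, T u & t = of_ground u) <->
  exists A : monotone_palgebra S,
    [/\ well_founded_palgebra A,
        (forall t, T t -> isSome (ground_interp A t)) &
        partial_model A R].
Proof.
split=> [terT|[A [wfA defT modelA]]]; last first.
  exact: partial_model_terminating modelA T wfA defT.
exists (SN_algebra R); split; first exact: SN_algebra_wf.
- move=> t Tt; rewrite /ground_interp.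
  have SNt : strongly_normalizing R (of_ground t).
    by apply: terminating_SN terT _; exists t.
  by rewrite (interp_SN_algebra _ SNt).
- exact: SN_algebra_model.
Qed.
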